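(* Let $0<q<1$, $N\in\mathbb N$ and $n\in\{1,\dots,N-1\}$ be fixed. The zeros of the quantum q-Krawtchouk polynomial $\widetilde K_n^{(\alpha)}(\cdot;q)$ ($\alpha>q^{1-N}$) are strictly decreasing functions of $\alpha$ on $(q^{1-N},\infty)$.
   Context: The quantum q-Krawtchouk polynomial is the polynomial of degree $n$ in $X$ (with $X=x(s)=q^{-s}$) given by $$\widetilde K_n^{(\alpha)}(X;q)=\frac{(q^{-N};q)_n}{\alpha^nq^{n^2}}\,{}_2\phi_1\left(\left.{q^{-n},\,X\atop q^{1-N}}\right|q,\alpha q^{n+1}\right)=\frac{(q^{-N};q)_n}{\alpha^nq^{n^2}}\sum_{k=0}^n\frac{(q^{-n};q)_k(X;q)_k}{(q^{1-N};q)_k(q;q)_k}\left(\alpha q^{n+1}\right)^k,$$ where $(u;q)_k=\prod_{j=0}^{k-1}(1-uq^j)$. Zeros are zeros in the variable $X$; there are $n$ of them, real and distinct, lying in $(1,q^{1-N})$. The statement refers to each zero (the zeros being arranged in increasing order) as a function of $\alpha$. *)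

(* Defs.v *)
From HB Require Import structures.
From mathcomp Require Import all_boot all_order all_algebra.
From mathcomp Require Import polyrcf.
From mathcomp Require Import reals.

Set Implicit Arguments.
Unset Strict Implicit.
Unset Printing Implicit Defensive.

Import Order.TTheory GRing.Theory Num.Theory.
Local Open Scope ring_scope.

(* q-Pochhammer symbol (u; q)_k over an arbitrary commutative ring: it is used
   both for scalars and, with u = 'X, for the polynomial (X; q)_k. *)
Definition qpoch (A : comNzRingType) (u q : A) (k : nat) : A :=
  \prod_(j < k) (1 - u * q ^+ j).

(* Powers of q with a possibly negative exponent are taken in int: N%:Z
   avoids truncated subtraction in q^(1-N). *)
Definition qtm_qKrawtchouk (R : realType) (q : R) (N n : nat) (alpha : R) :
    {poly R} :=
  (qpoch (q ^ (- N%:Z)) q n / (alpha ^+ n * q ^+ (n ^ 2))) *: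
  \sum_(k < n.+1)
    (qpoch (q ^ (- n%:Z)) q k / (qpoch (q ^ (1 - N%:Z)) q k * qpoch q q k)
       * (alpha * q ^+ n.+1) ^+ k) *: qpoch 'X q%:P k.

(* rootsR lists the distinct real roots of a nonzero polynomial in increasing
   order. *)
Definition qtm_qKrawtchouk_zeros (R : realType) (q : R) (N n : nat)
    (alpha : R) : seq R :=
  rootsR (qtm_qKrawtchouk q N n alpha).

(* The zero of index i (from 0) in increasing order; the value for an index
   beyond the number of zeros is 0. *)
Definition qtm_qKrawtchouk_zero (R : realType) (q : R) (N n i : nat)
    (alpha : R) : R :=
  (qtm_qKrawtchouk_zeros q N n alpha)`_i.

(* Main.v *)
Require Import Defs.
From HB Require Import structures.
From mathcomp Require Import all_boot all_order all_algebra.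
From mathcomp Require Import polyrcf.
From mathcomp Require Import reals.
From mathcomp Require Import ring lra zify.

Set Implicit Arguments.
Unset Strict Implicit.
Unset Printing Implicit Defensive.

Import Order.TTheory GRing.Theory Num.Theory.
Local Open Scope ring_scope.

(** With M = N - 1, the quantum q-Krawtchouk polynomial F(alpha, X) is orthogonal
    to all polynomials of degree < n in X for the weight
      w_s(alpha) = q^(s(s-1)/2) / ((q;q)_s (q;q)_(M-s))
                     * prod_(1 <= j <= M-s) (alpha q^j - 1)
    on the nodes q^(-s), 0 <= s <= M, which is positive for alpha > q^(-M); hence
    its n zeros are real and simple. The logarithmic derivative of w_s in alpha is
    strictly decreasing along the nodes, so Markov's argument (differentiate the
    orthogonality relation in alpha and test it with F / (X - z)) shows that
    dF/dalpha and dF/dX have the same strict sign at each zero z. By the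
    intermediate value theorem each zero then moves to the left when alpha
    increases a little, and a supremum argument makes this global. *)

(** * q-series *)

Lemma qpochS (A : comNzRingType) (u q : A) k :
  qpoch u q k.+1 = qpoch u q k * (1 - u * q ^+ k).
Proof. by rewrite /qpoch big_ord_recr. Qed.

Lemma qpochD (A : comNzRingType) (u q : A) k l :
  qpoch u q (k + l) = qpoch u q k * qpoch (u * q ^+ k) q l.
Proof.
elim: l => [|l IHl]; first by rewrite addn0 /qpoch big_ord0 mulr1.
by rewrite addnS !qpochS IHl -!mulrA exprD !mulrA.
Qed.

Lemma qpochSl (A : comNzRingType) (u q : A) k :
  qpoch u q k.+1 = (1 - u) * qpoch (u * q) q k.
Proof. by rewrite -add1n qpochD expr1 /qpoch big_ord1 expr0 mulr1. Qed.

Section QSeries.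
Variables (R : fieldType) (q : R).
Hypothesis q_neq0 : q != 0.
Hypothesis q_nonroot : forall k, 1 - q ^+ k.+1 != 0.

Lemma exprVSM k : q ^- k.+1 * q = q ^- k.
Proof. by rewrite exprSr invfM -mulrA mulVf ?mulr1. Qed.

Lemma qpochqS k : qpoch q q k.+1 = qpoch q q k * (1 - q ^+ k.+1).
Proof. by rewrite qpochS -exprS. Qed.

Lemma qpochq_neq0 k : qpoch q q k != 0.
Proof.
elim: k => [|k IHk]; first by rewrite /qpoch big_ord0 oner_neq0.
by rewrite qpochqS mulf_neq0.
Qed.

Lemma qpochV_vanish m n : (m < n)%N -> qpoch (q ^- m) q n = 0.
Proof.
move=> lt_mn; rewrite /qpoch (bigD1 (Ordinal lt_mn)) //= mulVf ?subrr ?mul0r //.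
by rewrite expf_neq0.
Qed.

(** The terminating q-binomial theorem, by a q-Pascal rule [tE] for the summands. Its product
    vanishes at z = q^i for 1 <= i <= n, which is the source of orthogonality. *)
Lemma qbinomial_thm n z :
  \sum_(k < n.+1) qpoch (q ^- n) q k / qpoch q q k * z ^+ k
  = \prod_(j < n) (1 - z * q ^- j.+1).
Proof.
elim: n => [|n IHn].
  by rewrite big_ord1 big_ord0 /qpoch !big_ord0 expr0 divr1 mulr1.
rewrite [RHS]big_ord_recr /= -IHn.
pose t k := qpoch (q ^- n) q k / qpoch q q k * z ^+ k.
have tE k : qpoch (q ^- n.+1) q k.+1 / qpoch q q k.+1 * z ^+ k.+1
    = t k.+1 - q ^- n.+1 * z * t k.
  have q1 := exprVSM n.
  rewrite /t qpochSl q1 qpochqS [qpoch (q ^- n) q k.+1]qpochS -q1.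
  rewrite -[q ^- n.+1 * q * _]mulrA -exprS.
  have := qpochq_neq0 k; have := q_nonroot k.
  move: (qpoch (q ^- n.+1 * q) q k) (qpoch q q k) (q ^- n.+1) (q ^+ k.+1) => b c d e e0 c0.
  by rewrite exprS; field; rewrite c0 e0.
rewrite big_ord_recl (eq_bigr (fun k : 'I_n.+1 => t k.+1 - q ^- n.+1 * z * t k));
  last by move=> k _; exact: tE.
rewrite sumrB -mulr_sumr.
(* The shifted sum gains [t n.+1], which vanishes, and loses [t 0 = 1]. *)
have -> : \sum_(k < n.+1) t k.+1 = \sum_(k < n.+1) t k - 1.
  have t0 : t 0%N = 1 by rewrite /t /qpoch !big_ord0 expr0 divr1 mulr1.
  rewrite -t0 big_ord_recr big_ord_recl /= {2}/t qpochV_vanish ?ltnSn //.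
  by rewrite !mul0r addr0 addrAC subrr add0r.
rewrite /= expr0 /qpoch !big_ord0 divr1 mulr1; rewrite -/(qpoch _ _ _).
by move: (\sum_(k < n.+1) t k) => S; ring.
Qed.

(** Up to a sign, the moment of (X; q)_k for the weight on the nodes q^(-s), s <= L, with [a] in
    place of q alpha. *)
Definition qtm_sum (L k : nat) (a : R) :=
  \sum_(s < L.+1) (-1) ^+ s * q ^+ 'C(s, 2) / (qpoch q q s * qpoch q q (L - s))
     * qpoch a q (L - s) * qpoch (q ^- s) q k.

(* Splits 1 - q^(L+1) = (1 - q^s) + q^s (1 - q^(L+1-s)) in each summand. *)
Lemma qtm_sumS0 L a :
  (1 - q ^+ L.+1) * qtm_sum L.+1 0 a = - a * q ^+ L * qtm_sum L 0 a.
Proof.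
pose t L s : R := (-1) ^+ s * q ^+ 'C(s, 2) / (qpoch q q s * qpoch q q (L - s))
     * qpoch a q (L - s).
have sumE K : qtm_sum K 0 a = \sum_(s < K.+1) t K s.
  by apply: eq_bigr => s _; rewrite [qpoch (_ ^- _) _ _]big_ord0 mulr1.
rewrite !sumE !mulr_sumr.
rewrite (eq_bigr (fun s : 'I_L.+2 => (1 - q ^+ s) * t L.+1 s
    + q ^+ s * (1 - q ^+ (L.+1 - s)) * t L.+1 s)); last first.
  move=> s _; rewrite -{1}(subnKC (ltnSE (ltn_ord s))) exprD; ring.
rewrite big_split /= big_ord_recl /= subrr mul0r add0r.
rewrite [X in _ + X]big_ord_recr /= subnn expr0 subrr mulr0 mul0r addr0.
rewrite -big_split /=; apply: eq_bigr => s _.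
rewrite /bump leq0n add1n /t subSS subSn ?(ltnSE (ltn_ord s)) //.
rewrite binS bin1 !qpochqS [qpoch a q _.+1]qpochS.
rewrite [q ^+ L](_ : _ = q ^+ s * q ^+ (L - s));
  last by rewrite -exprD subnKC // (ltnSE (ltn_ord s)).
rewrite [q ^+ (_ + _)]exprD [(-1) ^+ s.+1]exprS.
have := qpochq_neq0 s; have := qpochq_neq0 (L - s).
have := q_nonroot s; have := q_nonroot (L - s).
move: (qpoch q q (L - s)) (qpoch q q s) (qpoch a q (L - s)) (q ^+ 'C(s, 2)) ((-1) ^+ s).
move=> b c d e f; rewrite !exprS.
move: (q ^+ (L - s)) (q ^+ s) => g h h1 h2 h3 h4.
by field; rewrite h1 h2 h3 h4.
Qed.

(** The term s = 0 contains the factor 1 - 1; in the others 1 - q^(-s) cancels against the factor 1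
    - q^s of (q; q)_s and leaves - q^(-s). *)
Lemma qtm_sumSS L k a : qtm_sum L.+1 k.+1 a = q^-1 * qtm_sum L k a.
Proof.
rewrite {1}/qtm_sum big_ord_recl /= qpochSl expr0 invr1 subrr mul0r mulr0 add0r.
rewrite mulr_sumr; apply: eq_bigr => s _.
rewrite /bump leq0n add1n subSS [qpoch _ _ k.+1]qpochSl qpochqS binS bin1 exprD [(-1) ^+ s.+1]exprS.
rewrite exprVSM.
have := qpochq_neq0 s; have := qpochq_neq0 (L - s); have := q_nonroot s.
have : q ^+ s != 0 by rewrite expf_neq0.
rewrite [q ^+ s.+1]exprS.
move: (qpoch q q (L - s)) (qpoch q q s) (qpoch a q (L - s)) (q ^+ 'C(s, 2)) ((-1) ^+ s).
move: (qpoch (q ^- s) q k) (q ^+ s) => b c d e f g h h1 h2 h3 h4.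
by field; rewrite h1 h2 h3 h4 q_neq0.
Qed.

(** The factor (q^(-L); q)_k is what cancels the denominators of the polynomial. The induction
    lowers L and k together by [qtm_sumSS] and climbs back to L by [qtm_sumS0]. *)
Lemma qtm_sumE L k a : (k <= L)%N ->
  a ^+ k * qtm_sum L k a = qpoch (q ^- L) q k * qtm_sum L 0 a.
Proof.
elim: k L => [|k IHk] [|L] //.
- by rewrite expr0 /qpoch big_ord0.
- by rewrite expr0 /qpoch big_ord0.
rewrite ltnS => /IHk {}IHk.
have -> : qpoch (q ^- L.+1) q k.+1 = (1 - q ^- L.+1) * qpoch (q ^- L) q k.
  by rewrite qpochSl exprVSM.
rewrite qtm_sumSS.
have hS : (1 - q ^- L.+1) * qtm_sum L.+1 0 a = q^-1 * a * qtm_sum L 0 a.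
  have := qtm_sumS0 L a; rewrite exprS.
  have : q ^+ L != 0 by rewrite expf_neq0.
  move: (q ^+ L) (qtm_sum L.+1 0 a) (qtm_sum L 0 a) => c U V c0 E.
  apply: (mulfI (mulf_neq0 q_neq0 c0)); rewrite mulrA.
  rewrite [X in X * U](_ : _ = - (1 - q * c)).
    by rewrite mulNr E; field; rewrite q_neq0.
  by field; rewrite q_neq0 c0.
rewrite mulrAC hS exprS.
transitivity (q^-1 * a * (a ^+ k * qtm_sum L k a)); first by ring.
by rewrite IHk; ring.
Qed.
End QSeries.

(** * Orthogonality *)

Lemma horner_qpoch (R : fieldType) (p : {poly R}) (q x : R) k :
  (qpoch p q%:P k).[x] = qpoch p.[x] q k.
Proof. by rewrite horner_prod; apply: eq_bigr => j _; rewrite !hornerE. Qed.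

Lemma size_qpochX (R : fieldType) (c q : R) k : c != 0 -> q != 0 ->
  size (qpoch (c *: 'X) q%:P k) = k.+1.
Proof.
move=> c0 q0; elim: k => [|k IHk]; first by rewrite /qpoch big_ord0 size_poly1.
have e0 : c * q ^+ k != 0 by rewrite mulf_neq0 ?expf_neq0.
have fE : 1 - c *: 'X * q%:P ^+ k = - (c * q ^+ k) *: ('X - ((c * q ^+ k)^-1)%:P).
  have : (c * q ^+ k)%:P * ((c * q ^+ k)^-1)%:P = 1 :> {poly R}.
    by rewrite -polyCM mulfV.
  rewrite -polyC_exp -!mul_polyC polyCN {1}polyCM.
  move: (_ ^-1)%:P => e /(congr1 (fun p => p - c%:P * 'X * (q ^+ k)%:P)) <-.
  by rewrite polyCM; ring.
have s2 : size (1 - c *: 'X * q%:P ^+ k) = 2.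
  by rewrite fE size_scale ?size_XsubC // oppr_eq0.
rewrite qpochS size_mul ?s2 ?IHk -?size_poly_gt0 ?s2 ?IHk //.
by rewrite addn2.
Qed.

(* By triangularity, it is enough to test on one polynomial of each degree. *)
Lemma sum_horner_eq0 (R : fieldType) (I : finType) (v x : I -> R)
    (b : nat -> {poly R}) n :
  (forall m : nat, (m < n)%N -> size (b m) = m.+1) ->
  (forall m, (m < n)%N -> \sum_i v i * (b m).[x i] = 0) ->
  forall h : {poly R}, (size h <= n)%N -> \sum_i v i * h.[x i] = 0.
Proof.
elim: n => [|n IHn] sb hb h hn.
  move: hn; rewrite leqn0 size_poly_eq0 => /eqP->.
  by rewrite big1 // => i _; rewrite horner0 mulr0.
pose c := h`_n / (b n)`_n.
have bn0 : (b n)`_n != 0.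
  have := sb n (ltnSn n) => bn; have := lead_coef_eq0 (b n).
  by rewrite lead_coefE bn /= => ->; rewrite -size_poly_gt0 bn.
have : (size (h - c *: b n)%R <= n)%N.
  apply/leq_sizeP => j; rewrite leq_eqVlt coefB coefZ => /predU1P[<-|lt_nj].
    by rewrite /c mulfVK ?subrr.
  by rewrite !nth_default ?mulr0 ?subrr ?sb //; exact: leq_trans hn _.
move=> /(IHn (fun m lt => sb m (leqW lt)) (fun m lt => hb m (leqW lt))) => E.
rewrite (eq_bigr (fun i => v i * (h - c *: b n).[x i] + c * (v i * (b n).[x i]))).
  by rewrite big_split /= E -mulr_sumr hb // mulr0 addr0.
by move=> i _; rewrite !hornerE /=; ring.
Qed.

(* The outer variable is alpha and the inner one is X; M stands for N - 1, and
   the prefactor of the paper, which depends on alpha only, is dropped. *)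
Definition qtm_bipoly (R : fieldType) (q : R) (M n : nat) : {poly {poly R}} :=
  \poly_(k < n.+1)
    ((qpoch (q ^- n) q k / (qpoch (q ^- M) q k * qpoch q q k)
        * (q ^+ n.+1) ^+ k) *: qpoch 'X q%:P k).

(* The orthogonality weight at the node q^(-s), as a polynomial in alpha; the
   sign makes it positive for alpha > q^(-M). *)
Definition qtm_weight (R : fieldType) (q : R) (M s : nat) : {poly R} :=
  ((-1) ^+ (M + s) * q ^+ 'C(s, 2) / (qpoch q q s * qpoch q q (M - s)))
    *: qpoch (q *: 'X) q%:P (M - s).

Section Orthogonality.
Variables (R : fieldType) (q : R) (M n : nat).
Hypothesis q_neq0 : q != 0.
Hypothesis q_nonroot : forall k, 1 - q ^+ k.+1 != 0.
Hypothesis le_nM : (n <= M)%N.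

Lemma qpochV_neq0 m k : (k <= m)%N -> qpoch (q ^- m) q k != 0.
Proof.
move=> le_km; apply/prodf_neq0 => j _.
have lt_jm := leq_trans (ltn_ord j) le_km.
have := q_nonroot (m - j.+1); rewrite subnSK //; apply: contra => /eqP E.
rewrite subr_eq0; apply/eqP.
have qj0 : q ^+ j != 0 by rewrite expf_neq0.
move: E; rewrite -{1}(subnKC (ltnW lt_jm)) exprD invfM mulrAC mulVf // mul1r.
by move=> /eqP; rewrite subr_eq0 eq_sym => /eqP/(congr1 GRing.inv); rewrite invrK invr1.
Qed.

Lemma qtm_bipolyE a : (qtm_bipoly q M n).[a%:P] = \sum_(k < n.+1)
    (qpoch (q ^- n) q k / (qpoch (q ^- M) q k * qpoch q q k)
        * (a * q ^+ n.+1) ^+ k) *: qpoch 'X q%:P k.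
Proof.
rewrite horner_poly; apply: eq_bigr => k _.
by rewrite -polyC_exp mulrC mul_polyC scalerA exprMn; congr (_ *: _); ring.
Qed.

Lemma size_qtm_bipoly a : a != 0 -> size (qtm_bipoly q M n).[a%:P] = n.+1.
Proof.
move=> a0; rewrite qtm_bipolyE big_ord_recr /= addrC.
have sX k : size (qpoch 'X q%:P k) = k.+1.
  by rewrite -['X]scale1r size_qpochX ?oner_neq0.
have sT : size ((qpoch (q ^- n) q n / (qpoch (q ^- M) q n * qpoch q q n)
    * (a * q ^+ n.+1) ^+ n) *: qpoch 'X q%:P n) = n.+1.
  rewrite size_scale ?sX //.
  by rewrite !mulf_neq0 ?invr_neq0 ?mulf_neq0 ?expf_neq0 ?mulf_neq0 ?expf_neq0
    ?qpochV_neq0 ?qpochq_neq0.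
rewrite size_polyDl sT // ltnS; apply: leq_trans (size_sum _ _ _) _.
apply/bigmax_leqP => k _.
by apply: leq_trans (size_scale_leq _ _) _; rewrite sX.
Qed.

Lemma size_deriv_qtm_bipoly a : (size (qtm_bipoly q M n)^`().[a%:P] <= n.+1)%N.
Proof.
rewrite horner_coef; apply: leq_trans (size_sum _ _ _) _.
apply/bigmax_leqP => k _; rewrite -polyC_exp mulrC mul_polyC.
apply: leq_trans (size_scale_leq _ _) _.
rewrite coef_deriv coef_poly; case: ifP => [lt_kn|_]; last by rewrite mul0rn size_poly0.
rewrite -scaler_nat scalerA; apply: leq_trans (size_scale_leq _ _) _.
by rewrite -['X]scale1r size_qpochX ?oner_neq0.
Qed.

(* The factor (alpha q^(M+1) X; q)_m lengthens the Pochhammer symbol contained in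
   the weight, which turns every inner sum into a [qtm_sum]. *)
Lemma qtm_orthogonal_basis a m : (m < n)%N ->
  \sum_(s < M.+1) (qtm_weight q M s).[a] * (qtm_bipoly q M n).[a%:P].[q ^- s]
     * (qpoch ((a * q ^+ M.+1) *: 'X) q%:P m).[q ^- s] = 0.
Proof.
move=> lt_mn; pose A := a * q ^+ m.+1.
pose c k := qpoch (q ^- n) q k / (qpoch (q ^- M) q k * qpoch q q k)
               * (a * q ^+ n.+1) ^+ k.
pose K := (-1) ^+ M * qpoch (a * q) q m.
have step (s : 'I_M.+1) :
   (qtm_weight q M s).[a] * (qtm_bipoly q M n).[a%:P].[q ^- s]
     * (qpoch ((a * q ^+ M.+1) *: 'X) q%:P m).[q ^- s]
   = \sum_(k < n.+1) c k * K *
       ((-1) ^+ s * q ^+ 'C(s, 2) / (qpoch q q s * qpoch q q (M - s))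
     * qpoch A q (M - s) * qpoch (q ^- s) q k).
  rewrite qtm_bipolyE horner_sum mulrAC mulr_sumr; apply: eq_bigr => k _.
  rewrite !hornerZ !horner_qpoch !hornerZ !hornerX.
  have -> : a * q ^+ M.+1 * q ^- s = q * a * q ^+ (M - s).
    have qs0 : q ^+ s != 0 by rewrite expf_neq0.
    by rewrite -{1}(subnK (ltnSE (ltn_ord s))) exprS exprD; field; rewrite qs0.
  (* Both sides are (q alpha; q)_(M-s+m), cut after M - s or after m factors; the second cut
     isolates a prefix independent of s. *)
  have E : qpoch (q * a) q (M - s) * qpoch (q * a * q ^+ (M - s)) q m
      = qpoch (a * q) q m * qpoch A q (M - s).
    have -> : A = q * a * q ^+ m by rewrite /A exprS; ring.
    by rewrite -qpochD addnC qpochD [a * q]mulrC.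
  rewrite exprD /K -/(c k).
  transitivity (c k * (-1) ^+ M * ((-1) ^+ s * q ^+ 'C(s, 2) / (qpoch q q s * qpoch q q (M - s)))
    * qpoch (q ^- s) q k * (qpoch (q * a) q (M - s) * qpoch (q * a * q ^+ (M - s)) q m)).
    by ring.
  by rewrite E; ring.
rewrite (eq_bigr _ (fun s _ => step s)) exchange_big /=.
under eq_bigr => k _ do rewrite -mulr_sumr -/(qtm_sum q M k A).
(* Since alpha q^(n+1) = q^(n-m) A, [qtm_sumE] absorbs A^k and leaves a q-binomial sum at z =
   q^(n-m). *)
rewrite (eq_bigr (fun k : 'I_n.+1 => K * qtm_sum q M 0 A *
   (qpoch (q ^- n) q k / qpoch q q k * (q ^+ (n - m)) ^+ k))); last first.
  move=> k _; have le_kM := leq_trans (ltnSE (ltn_ord k)) le_nM.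
  have := qtm_sumE q_neq0 q_nonroot A le_kM.
  rewrite /c; have := qpochV_neq0 le_kM; have := qpochq_neq0 q_nonroot k.
  have -> : a * q ^+ n.+1 = q ^+ (n - m) * A.
    by rewrite /A -{1}(subnK (ltnW lt_mn)) -addnS exprD; ring.
  rewrite [(q ^+ (n - m) * A) ^+ k]exprMn.
  move: (qtm_sum q M k A) (qtm_sum q M 0 A) (A ^+ k) => S S0 Ak.
  move: (qpoch (q ^- M) q k) => d b0 d0 E.
  transitivity (K * (Ak * S) * (qpoch (q ^- n) q k / (d * qpoch q q k) * (q ^+ (n - m)) ^+ k)).
    by ring.
  by rewrite E; field; rewrite b0 d0.
rewrite -mulr_sumr qbinomial_thm //.
(* The factor of index n - m - 1 is 1 - q^(n-m) q^(-(n-m)) = 0; it occurs because m < n. *)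
have lt_j : (n - m.+1 < n)%N by rewrite ltn_subrL (leq_ltn_trans _ lt_mn).
rewrite (bigD1 (Ordinal lt_j)) //= subnSK // mulfV ?expf_neq0 //.
by rewrite subrr mul0r mulr0.
Qed.

Lemma qtm_orthogonal a (h : {poly R}) : a != 0 -> (size h <= n)%N ->
  \sum_(s < M.+1) (qtm_weight q M s).[a] * (qtm_bipoly q M n).[a%:P].[q ^- s]
     * h.[q ^- s] = 0.
Proof.
move=> a0; pose b m := qpoch ((a * q ^+ M.+1) *: 'X) q%:P m.
apply: (@sum_horner_eq0 _ _ _ (fun s : 'I_M.+1 => q ^- s) b) => m lt_mn.
  by rewrite size_qpochX ?mulf_neq0 ?expf_neq0.
exact: qtm_orthogonal_basis.
Qed.
End Orthogonality.

(** * Differentiation of the orthogonality relation in alpha *)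

Definition poly_at (R : comNzRingType) (x : R) (F : {poly {poly R}}) : {poly R} :=
  map_poly (horner_eval x) F.

Lemma horner_poly_at (R : comNzRingType) (F : {poly {poly R}}) (x a : R) :
  (poly_at x F).[a] = F.[a%:P].[x].
Proof.
by rewrite -[RHS]/(horner_eval x _) -horner_map /= horner_evalE hornerC.
Qed.

Lemma deriv_poly_at (R : comNzRingType) (F : {poly {poly R}}) (x : R) :
  (poly_at x F)^`() = poly_at x F^`().
Proof. exact: deriv_map. Qed.

(** The nonzero points 1, 2, 3, ... outnumber the roots of any nonzero p. This serves to extend the
    orthogonality relation, known for alpha != 0, to a polynomial identity. *)
Lemma poly_eq0_horner (R : numFieldType) (p : {poly R}) :
  (forall a, a != 0 -> p.[a] = 0) -> p = 0.
Proof.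
move=> hp; apply/eqP; apply/negPn/negP => p0.
have := @max_poly_roots _ p (mkseq (fun i => i.+1%:R) (size p)) p0.
rewrite size_mkseq ltnn => H; suff: false by []; apply: H.
  apply/allP => x /mapP[i _ ->]; apply/rootP/hp; by rewrite pnatr_eq0.
by rewrite mkseq_uniq // => i j /eqP; rewrite eqr_nat eqSS => /eqP.
Qed.

(** For [h] independent of alpha the orthogonality sum is a polynomial in alpha that vanishes off 0,
    hence is zero; so is its formal derivative. *)
Lemma qtm_orthogonal_deriv (R : numFieldType) (q : R) (M n : nat) :
  q != 0 -> (forall k, 1 - q ^+ k.+1 != 0) -> (n <= M)%N ->
  forall a (h : {poly R}), (size h <= n)%N ->
  \sum_(s < M.+1) ((qtm_weight q M s)^`().[a] * (qtm_bipoly q M n).[a%:P].[q ^- s]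
     + (qtm_weight q M s).[a] * (qtm_bipoly q M n)^`().[a%:P].[q ^- s])
     * h.[q ^- s] = 0.
Proof.
move=> q0 q1 le_nM a h hn.
have Z : \sum_(s < M.+1) qtm_weight q M s
    * poly_at (q ^- s) (qtm_bipoly q M n) * (h.[q ^- s])%:P = 0.
  apply: poly_eq0_horner => b b0; rewrite horner_sum.
  rewrite -[RHS](qtm_orthogonal q0 q1 le_nM b0 hn).
  by apply: eq_bigr => s _; rewrite !hornerM hornerC horner_poly_at.
have := congr1 (fun p => p^`().[a]) Z; rewrite deriv0 horner0 => {2}<-.
rewrite raddf_sum horner_sum; apply: eq_bigr => s _ /=.
rewrite derivM derivC mulr0 addr0 derivM hornerM hornerC hornerD !hornerM.
by rewrite deriv_poly_at !horner_poly_at.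
Qed.

(** * Discrete orthogonality and Markov's argument *)

Lemma poly_vanish_points (R : idomainType) (I : finType) (x : I -> R)
    (p : {poly R}) :
  injective x -> (size p <= #|I|)%N -> (forall i, p.[x i] = 0) -> p = 0.
Proof.
move=> x_inj le_pI px0; apply/eqP/negPn/negP => p0.
have := @max_poly_roots _ p [seq x i | i : I] p0.
rewrite size_image ltnNge le_pI => H; suff: false by []; apply: H.
  by apply/allP => _ /imageP[i _ ->]; apply/rootP.
by rewrite map_inj_uniq ?enum_uniq.
Qed.

Lemma mem_rootsR (R : rcfType) (p : {poly R}) (z : R) :
  p != 0 -> (z \in rootsR p) = root p z.
Proof. by move=> p0; rewrite -(roots_on_rootsR p0) in_itv. Qed.

Lemma poly_no_root_sign (R : rcfType) (p : {poly R}) :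
  (forall x, ~~ root p x) -> (forall x, 0 <= p.[x]) \/ (forall x, p.[x] <= 0).
Proof.
move=> nr; have ivt a b : 0 < p.[a] -> ~ p.[b] < 0.
  move=> pa pb; case: (leP a b) => [le_ab|/ltW le_ba].
    have [|y _ /(negP (nr y))//] := @poly_ivtoo _ p _ _ le_ab.
    by rewrite pmulr_rlt0.
  have [|y _ /(negP (nr y))//] := @poly_ivtoo _ p _ _ le_ba.
  by rewrite nmulr_rlt0.
case: (ltP 0 p.[0]) => p0; [left|right] => x; rewrite leNgt; apply/negP.
  by move=> px; exact: (ivt _ _ p0 px).
by move=> px; apply: (ivt _ 0 px); rewrite lt_neqAle p0 andbT; exact: nr.
Qed.

(* [s] collects the roots of odd multiplicity. *)
Lemma poly_sign_changes (R : rcfType) (p : {poly R}) : p != 0 ->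
  exists s : seq R, [/\ uniq s, all (root p) s &
    (forall x, 0 <= (p * \prod_(z <- s) ('X - z%:P)).[x]) \/
    (forall x, (p * \prod_(z <- s) ('X - z%:P)).[x] <= 0)].
Proof.
elim: {p}(size p) {-2}p (leqnn (size p)) => [|k IHk] p le_pk p0.
  by move: le_pk; rewrite leqn0 size_poly_eq0 (negPf p0).
have [E|[z pz]] : rootsR p = [::] \/ exists z, root p z.
  case E: (rootsR p) => [|z s]; [by left | right; exists z].
  by rewrite -(mem_rootsR _ p0) E mem_head.
  exists [::]; split=> //; rewrite big_nil mulr1.
  apply: poly_no_root_sign => x; by rewrite -(mem_rootsR _ p0) E.
have [p1 Dp] := factor_theorem _ _ pz.
have p10 : p1 != 0 by apply: contraNneq p0 => E; rewrite Dp E mul0r.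
have [] := IHk p1 => //.
  by move: le_pk; rewrite Dp size_Mmonic ?monicXsubC // size_XsubC addn2.
move=> s [s_uniq s_root s_sign].
have p1p y : root p1 y -> root p y by rewrite Dp rootM => ->.
(* If [z] is already in [s], its multiplicity becomes even and it leaves the list; otherwise it
   joins the list and the product gains (X - z)^2. *)
have [z_s|z_s] := boolP (z \in s).
  exists (rem z s); split; first exact: rem_uniq.
    by apply/allP => y /mem_rem /(allP s_root) /p1p.
  have -> : p * \prod_(y <- rem z s) ('X - y%:P) = p1 * \prod_(y <- s) ('X - y%:P).
    by rewrite Dp (perm_big _ (perm_to_rem z_s)) big_cons mulrA.
  exact: s_sign.
exists (z :: s); split; first by rewrite /= z_s.
  by rewrite /= pz; apply/allP => y /(allP s_root) /p1p.
have E x : (p * \prod_(y <- z :: s) ('X - y%:P)).[x]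
    = (x - z) ^+ 2 * (p1 * \prod_(y <- s) ('X - y%:P)).[x].
  by rewrite big_cons Dp !hornerE /=; ring.
case: s_sign => sg; [left | right] => x; rewrite E.
  by rewrite mulr_ge0 ?sqr_ge0.
by rewrite mulr_ge0_le0 ?sqr_ge0.
Qed.

Lemma size_rootsR_le (R : rcfType) (p : {poly R}) : p != 0 ->
  (size (rootsR p) < size p)%N.
Proof.
move=> p0; apply: max_poly_roots => //; last exact: uniq_roots.
by apply/allP => z; rewrite mem_rootsR.
Qed.

Section DiscreteOrthogonality.
Variables (R : rcfType) (I : finType) (x w : I -> R) (n : nat) (p : {poly R}).
Hypothesis x_inj : injective x.
Hypothesis w_gt0 : forall i, 0 < w i.
Hypothesis lt_nI : (n < #|I|)%N.
Hypothesis size_p : size p = n.+1.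
Hypothesis p_orth : forall h : {poly R}, (size h <= n)%N ->
  \sum_i w i * p.[x i] * h.[x i] = 0.

(** There are more nodes than the degree n. Such a node makes the later inequalities between sums
    strict. *)
Lemma orthogonal_nonzero_point : exists i, p.[x i] != 0.
Proof.
case: (pickP (fun i => p.[x i] != 0)) => [i|H]; first by exists i.
have : p = 0.
  apply: (poly_vanish_points x_inj); first by rewrite size_p.
  by move=> i; apply/eqP; rewrite -[_ == _]negbK H.
by move=> E; move: size_p; rewrite E size_poly0.
Qed.

(** With fewer than n sign changes, p times the product over them has constant sign but weighted sum
    0, so it vanishes at every node; this fails where p is nonzero. *)
Lemma orthogonal_size_rootsR : size (rootsR p) = n.
Proof.
have p0 : p != 0 by rewrite -size_poly_gt0 size_p.
apply/eqP; rewrite eqn_leq -ltnS -{1}size_p size_rootsR_le //=.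
have [s [s_uniq s_root s_sign]] := poly_sign_changes p0.
have le_s : (size s <= size (rootsR p))%N.
  apply: uniq_leq_size => // z /(allP s_root) pz.
  by rewrite mem_rootsR.
apply: leq_trans le_s; rewrite leqNgt; apply/negP => lt_sn.
have hs : (size (\prod_(z <- s) ('X - z%:P))%R <= n)%N by rewrite size_prod_XsubC.
have [i0 pi0] := orthogonal_nonzero_point.
have S0 := p_orth hs.
have Z i : w i * (p * \prod_(z <- s) ('X - z%:P)).[x i] = 0.
  have S1 : \sum_i w i * (p * \prod_(z <- s) ('X - z%:P)).[x i] = 0.
    by rewrite -[RHS]S0; apply: eq_bigr => j _; rewrite hornerM mulrA.
  case: s_sign => sg.
    apply: (psumr_eq0P _ S1) => // j _; exact: mulr_ge0 (ltW (w_gt0 j)) (sg _).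
  apply/eqP; rewrite -oppr_eq0; apply/eqP.
  apply: (@psumr_eq0P _ _ xpredT (fun j => - (w j * _))) => // [j _|].
    by rewrite oppr_ge0 mulr_ge0_le0 // ltW.
  by rewrite sumrN S1 oppr0.
have := Z i0 => /eqP; rewrite mulf_eq0 gt_eqF //= hornerM mulf_eq0 (negPf pi0) /=.
rewrite horner_prod prodf_seq_eq0 => /hasP[z /(allP s_root) /rootP pz].
rewrite !hornerE subr_eq0 => /eqP E.
by move: pi0; rewrite E pz eqxx.
Qed.

(* [u] plays the role of the derivative of [p] with respect to a parameter, and
   [l] that of the logarithmic derivative of the weight. Test both orthogonality
   relations with g = p / (X - z): since sum w p g = 0, one may subtract from [l]
   a constant separating its values on the two sides of [z], after which all
   terms of sum w l p g have the same sign. *)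
Lemma markov_sign (l : I -> R) (u : {poly R}) (z : R) :
  (forall i j, x i < x j -> l j < l i) ->
  (size u <= n.+1)%N ->
  (forall h : {poly R}, (size h <= n)%N ->
    \sum_i (w i * l i * p.[x i] + w i * u.[x i]) * h.[x i] = 0) ->
  root p z -> 0 < u.[z] * p^`().[z].
Proof.
move=> l_decr size_u u_orth pz.
have factor_at (f : {poly R}) : (size f <= n.+1)%N ->
    exists2 g : {poly R}, (size g <= n)%N & forall y, f.[y] = f.[z] + (y - z) * g.[y].
  move=> sf; have : root (f - f.[z]%:P) z by rewrite /root !hornerE subrr.
  move=> /factor_theorem[g Dg]; exists g.
    have [->|g0] := eqVneq g 0; first by rewrite size_poly0.
    rewrite -ltnS -[(size g).+1]addn1.
    have : (size (f - f.[z]%:P)%R <= n.+1)%N.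
      rewrite (leq_trans (size_polyD _ _)) // geq_max sf size_polyN.
      by rewrite (leq_trans (size_polyC_leq1 _)).
    by rewrite Dg size_Mmonic ?monicXsubC // size_XsubC addn2 addn1.
  move=> y; have := congr1 (fun r => r.[y]) Dg; rewrite !hornerE /= => E.
  by rewrite mulrC -E addrC subrK.
have [g Dp] := factor_theorem _ _ pz.
have g0 : g != 0 by apply: contra_eqN size_p => /eqP E; rewrite Dp E mul0r size_poly0.
have size_g : (size g <= n)%N.
  by rewrite -ltnS -size_p Dp size_Mmonic ?monicXsubC // size_XsubC addn2.
have pE y : p.[y] = (y - z) * g.[y] by rewrite Dp !hornerE mulrC.
have -> : p^`().[z] = g.[z].
  by rewrite Dp derivM derivXsubC !hornerE subrr mulr0 add0r.
pose G := \sum_i w i * g.[x i].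
(* A quadrature at z: f - f(z) = (X - z) v, and (X - z) g = p is orthogonal to v, so only f(z)
   contributes. *)
have reduce (f : {poly R}) : (size f <= n.+1)%N ->
    \sum_i w i * f.[x i] * g.[x i] = f.[z] * G.
  move=> /factor_at[v size_v fE].
  rewrite (eq_bigr (fun i => f.[z] * (w i * g.[x i]) + w i * p.[x i] * v.[x i])).
    by rewrite big_split /= p_orth // addr0 -mulr_sumr.
  by move=> i _; rewrite fE pE; ring.
(* The choice f = g shows that g(z) = p'(z) and [G] have the same sign. *)
have gg : 0 < g.[z] * G.
  rewrite -reduce ?(leq_trans size_g) //.
  have [i0 pi0] := orthogonal_nonzero_point.
  rewrite (bigD1 i0) //=; apply: ltr_wpDr.
    by apply: sumr_ge0 => i _; rewrite -mulrA -expr2 mulr_ge0 ?sqr_ge0 ?ltW.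
  rewrite -mulrA mulr_gt0 // -expr2 exprn_even_gt0 //=.
  by apply: contraNneq pi0 => E; rewrite pE E mulr0.
(* These terms have the sign of x_i - z where g is nonzero, and they sum to 0 without all vanishing;
   so both signs occur. *)
pose a i := w i * p.[x i] * g.[x i].
have aE i : a i = w i * g.[x i] ^+ 2 * (x i - z) by rewrite /a pE; ring.
have sum_a : \sum_i a i = 0 by exact: p_orth.
have [i0 pi0] := orthogonal_nonzero_point.
have a0 : a i0 != 0.
  move: pi0; rewrite pE mulf_eq0 negb_or aE => /andP[h1 h2].
  by rewrite !mulf_neq0 ?expf_neq0 // gt_eqF.
have wg2_ge0 i : 0 <= w i * g.[x i] ^+ 2 by rewrite mulr_ge0 ?sqr_ge0 ?ltW.
have [i3 ai3] : exists i, a i < 0.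
  case: (pickP (fun i => a i < 0)) => [i|H]; first by exists i.
  case/eqP: a0; apply: (psumr_eq0P _ sum_a) => // i _.
  by rewrite leNgt H.
have [i2 ai2] : exists i, 0 < a i.
  case: (pickP (fun i => 0 < a i)) => [i|H]; first by exists i.
  case/eqP: a0; apply/eqP; rewrite -oppr_eq0; apply/eqP.
  apply: (@psumr_eq0P _ _ xpredT (fun j => - a j)) => // [j _|].
    by rewrite oppr_ge0 leNgt H.
  by rewrite sumrN sum_a oppr0.
have xi2 : z <= x i2.
  rewrite leNgt; apply/negP => lt_z; move: ai2; apply/negP; rewrite -leNgt aE.
  by rewrite mulr_ge0_le0 // subr_le0 ltW.
have xi3 : x i3 < z.
  rewrite ltNge; apply/negP => le_z; move: ai3; apply/negP; rewrite -leNgt aE.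
  by rewrite mulr_ge0 // subr_ge0.
(* The separating constant is the value of [l] at the first node not left of z; [i2] shows that
   there is one. *)
case: (arg_minP (P := fun i => z <= x i) x xi2) => j zj j_min.
have l_right i : z <= x i -> l i <= l j.
  move=> /j_min; rewrite le_eqVlt => /predU1P[/x_inj->//|/l_decr/ltW//].
have l_left i : x i < z -> l j < l i by move=> h; apply: l_decr; exact: lt_le_trans zj.
have neg : \sum_i l i * a i < 0.
  have -> : \sum_i l i * a i = \sum_i (l i - l j) * a i.
    under [RHS]eq_bigr => i _ do rewrite mulrBl.
    by rewrite sumrB -mulr_sumr sum_a mulr0 subr0.
  rewrite -oppr_gt0 -sumrN (bigD1 i3) //=; apply: ltr_wpDr.
    apply: sumr_ge0 => i _; rewrite oppr_ge0 aE; case: (leP z (x i)) => zi.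
      by rewrite mulr_le0_ge0 ?subr_le0 ?l_right // mulr_ge0 // subr_ge0.
    by rewrite mulr_ge0_le0 ?subr_ge0 ?(ltW (l_left _ zi)) // mulr_ge0_le0 // subr_le0 ltW.
  by rewrite oppr_gt0 pmulr_rlt0 // subr_gt0 l_left.
(* By the relation for [u] tested on g, u(z) G = sum w u g = - sum l a. *)
have uG : 0 < u.[z] * G.
  rewrite -reduce // -oppr_lt0.
  have := u_orth g size_g.
  rewrite (eq_bigr (fun i => l i * a i + w i * u.[x i] * g.[x i])); last first.
    by move=> i _; rewrite /a; ring.
  by rewrite big_split /= => /(canRL (addrK _)); rewrite sub0r => <-.
have G0 : G != 0 by apply: contraTneq uG => ->; rewrite mulr0 ltxx.
have G2 : 0 < G ^+ 2 by rewrite exprn_even_gt0.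
have E : u.[z] * g.[z] * G ^+ 2 = (u.[z] * G) * (g.[z] * G) by ring.
by rewrite -(pmulr_lgt0 _ G2) E mulr_gt0.
Qed.
End DiscreteOrthogonality.

(** * Monotonicity of the roots of a one-parameter family *)

(** One-sided neighbourhoods of 0, closed under finite intersections, so that finitely many
    conditions on a step can be met at once. *)
Definition small (R : numDomainType) (P : R -> Prop) :=
  exists2 d, 0 < d & forall e, 0 < e -> e < d -> P e.

Lemma small_and (R : realDomainType) (P Q : R -> Prop) :
  small P -> small Q -> small (fun e => P e /\ Q e).
Proof.
move=> [d d0 dP] [c c0 cQ]; exists (Num.min d c); first by rewrite lt_min d0.
by move=> e e0; rewrite lt_min => /andP[ed ec]; split; [exact: dP | exact: cQ].
Qed.

Lemma small_forall (R : realDomainType) (I : finType) (P : I -> R -> Prop) :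
  (forall i, small (P i)) -> small (fun e => forall i, P i e).
Proof.
move=> /fin_all_exists2[d d0 dP]; exists (\big[Num.min/1]_i d i).
  by apply: lt_bigmin => // i _; exact: d0.
by move=> e e0 ed i; apply: dP => //; exact: lt_le_trans ed (bigmin_le _ _ _).
Qed.

Lemma small_lt (R : realDomainType) (c : R) : 0 < c -> small (fun e => e < c).
Proof. by exists c. Qed.

Lemma small_ex (R : realFieldType) (P : R -> Prop) :
  small P -> exists2 e, 0 < e & P e.
Proof.
move=> [d d0 dP]; have d2 : 0 < d / 2 by lra.
by exists (d / 2) => //; apply: dP => //; lra.
Qed.

(** The factor [c] carries the sign of p(x), so that both signs are treated at once. *)
Lemma horner_sign_near (R : rcfType) (p : {poly R}) (x c : R) :
  0 < p.[x] * c -> small (fun e => 0 < p.[x + e] * c /\ 0 < p.[x - e] * c).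
Proof.
move=> pc; have [d d0 dP] := poly_cont x (p * c%:P) pc.
exists d => // e e0 ed.
have H y : `|y - x| < d -> 0 < p.[y] * c.
  by move=> /dP; rewrite !hornerM !hornerC ltr_norml => /andP[? _]; lra.
split; apply: H.
  by rewrite addrAC subrr add0r gtr0_norm.
by rewrite addrAC subrr add0r normrN gtr0_norm.
Qed.

(** Here p = g (X - z) with g(z) = p'(z), and g keeps its sign near z. *)
Lemma simple_root_sign (R : rcfType) (p : {poly R}) (z c : R) :
  root p z -> 0 < p^`().[z] * c ->
  small (fun e => 0 < p.[z + e] * c /\ p.[z - e] * c < 0).
Proof.
move=> /factor_theorem[g ->]; rewrite derivM derivXsubC !hornerE subrr mulr0 add0r.
move=> /horner_sign_near[d d0 dP]; exists d => // e e0 ed.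
have [h1 h2] := dP e e0 ed; rewrite !hornerE /=; split.
  by rewrite mulrAC pmulr_rgt0 // addrAC subrr add0r.
by rewrite mulrAC pmulr_rlt0 // addrAC subrr add0r oppr_lt0.
Qed.

(** The intervals are ordered, disjoint and as many as the roots, so each holds exactly one root, of
    the same rank. *)
Lemma rootsR_localized (R : rcfType) (p : {poly R}) (n : nat) (A B : nat -> R) :
  p != 0 -> size (rootsR p) = n ->
  (forall j, (j < n)%N -> exists2 z, A j < z < B j & root p z) ->
  (forall j, (j.+1 < n)%N -> B j <= A j.+1) ->
  forall j, (j < n)%N -> A j < (rootsR p)`_j < B j.
Proof.
move=> p0 sz rt AB; pose Z j := (roots p (A j) (B j))`_0.
have ZP j : (j < n)%N -> (A j < Z j < B j) && root p (Z j).
  move=> /rt[z zj pz].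
  have : Z j \in roots p (A j) (B j).
    apply: mem_nth; have : z \in roots p (A j) (B j).
      by rewrite -(roots_on_roots _ _ p0) pz andbT.
    by case: (roots _ _ _).
  by rewrite -(roots_on_roots _ _ p0).
have Zsorted : sorted <%R (mkseq Z n).
  apply/(sortedP 0) => j; rewrite size_mkseq => lt_jn.
  rewrite !nth_mkseq //; last exact: ltnW.
  have /andP[/andP[_ h1] _] := ZP j (ltnW lt_jn).
  have /andP[/andP[h2 _] _] := ZP _ lt_jn.
  exact: lt_trans h1 (le_lt_trans (AB _ lt_jn) h2).
have sub : {subset mkseq Z n <= rootsR p}.
  move=> x /mapP[j]; rewrite mem_iota add0n => /andP[_ /ZP/andP[_ pz]] ->.
  by rewrite mem_rootsR.
have [|_ eq_mem] := uniq_min_size (lt_sorted_uniq Zsorted) sub.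
  by rewrite size_mkseq sz.
have -> : rootsR p = mkseq Z n.
  by apply: (lt_sorted_eq (sorted_roots _ _ _) Zsorted) => z; rewrite eq_mem.
by move=> j lt_jn; rewrite nth_mkseq //; case/andP: (ZP j lt_jn).
Qed.

(** The inequality to the right of a point prolongs an interval on which f < f(a); the one to the
    left carries the bound to the supremum of such intervals, which must then be [b]. *)
Lemma local_decreasing (R : realType) (f : R -> R) (a0 : R) :
  (forall c, a0 < c -> small (fun e => f (c + e) < f c /\ f c < f (c - e))) ->
  forall a b, a0 < a -> a < b -> f b < f a.
Proof.
move=> loc a b a0a ab.
pose E t := [/\ a < t, t <= b & forall s, a < s -> s <= t -> f s < f a].
have ubE : classical_sets.has_ubound (E : classical_sets.set R) by exists b => t [].
have extend c : a <= c -> c < b -> (forall s, a < s -> s <= c -> f s < f a) ->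
    exists2 t, c < t & E t.
  move=> ac cb cE; have [d d0 dP] := loc c (lt_le_trans a0a ac).
  have m0 : 0 < Num.min (b - c) (d / 2) by rewrite lt_min subr_gt0 cb; lra.
  have m1 : Num.min (b - c) (d / 2) <= b - c by rewrite ge_min lexx.
  have m2 : Num.min (b - c) (d / 2) <= d / 2 by rewrite ge_min lexx orbT.
  exists (c + Num.min (b - c) (d / 2)); first lra.
  split; [lra | lra |] => s as_ st; have [sc|cs] := leP s c; first exact: cE.
  have sc0 : 0 < s - c by rewrite subr_gt0.
  have scd : s - c < d by lra.
  have [h _] := dP _ sc0 scd; rewrite addrC subrK in h.
  move: ac; rewrite le_eqVlt => /predU1P[->//|ac].
  exact: lt_trans h (cE c ac (lexx c)).
have [t0 at0 Et0] : exists2 t, a < t & E t.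
  by apply: extend => // s h1 h2; have := lt_le_trans h1 h2; rewrite ltxx.
have supE : classical_sets.has_sup (E : classical_sets.set R) by split => //; exists t0.
pose c := sup (E : classical_sets.set R).
have t0c : t0 <= c by exact: (sup_upper_bound supE).
have ac : a < c := lt_le_trans at0 t0c.
have cb : c <= b by apply: ge_sup; [exists t0 | move=> t []].
have below s : a < s -> s < c -> f s < f a.
  move=> as_ sc; have sc0 : 0 < c - s by rewrite subr_gt0.
  have [t [_ _ tE]] := sup_adherent sc0 supE; rewrite -/c subKr => st.
  exact: tE as_ (ltW st).
have fc : f c < f a.
  have ca0 : 0 < c - a by rewrite subr_gt0.
  have [e e0 [[_ h] ec]] := small_ex (small_and (loc c (lt_trans a0a ac)) (small_lt ca0)).
  apply: lt_trans h _; apply: below; lra.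
move: cb; rewrite le_eqVlt => /predU1P[<- //|cb].
have [|t ct Et] := extend c (ltW ac) cb.
  move=> s as_; rewrite le_eqVlt => /predU1P[->//|]; exact: below.
by have := sup_upper_bound supE Et; rewrite leNgt ct.
Qed.

(** The opposite signs of F at r_j - h and r_j + h persist for alpha = a + e and a - e, while at r_j
    itself F takes the sign of dF/dX for a + e and the opposite one for a - e. This traps a zero
    left of r_j in the first case, right of it in the second. *)
Lemma rootsR_decreasing (R : realType) (F : {poly {poly R}}) (a0 : R) (n : nat) :
  (forall a, a0 < a -> F.[a%:P] != 0) ->
  (forall a, a0 < a -> size (rootsR F.[a%:P]) = n) ->
  (forall a z, a0 < a -> root F.[a%:P] z ->
     0 < F^`().[a%:P].[z] * F.[a%:P]^`().[z]) ->
  forall i, (i < n)%N -> forall a b, a0 < a -> a < b ->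
    (rootsR F.[b%:P])`_i < (rootsR F.[a%:P])`_i.
Proof.
move=> F0 Fsz Fsgn i lt_in; apply: (local_decreasing (f := fun a => _)) => a a0a.
set p := F.[a%:P]; pose r (j : nat) := (rootsR p)`_j; pose D j := p^`().[r j].
have p_root j : (j < n)%N -> root p (r j).
  by move=> ltjn; rewrite -mem_rootsR ?F0 // mem_nth // Fsz.
have rS (j : nat) : (j.+1 < n)%N -> r j < r j.+1.
  by move=> ltjn; apply: (sortedP 0 _) => //; [exact: sorted_roots | rewrite Fsz].
have DD (j : 'I_n) : 0 < D j * D j.
  have := Fsgn a (r j) a0a (p_root j (ltn_ord j)); rewrite -/p -/(D j) => h.
  by rewrite -expr2 exprn_even_gt0 //; apply: contraTneq h => ->; rewrite mulr0 ltxx.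
(* Half the distance to the next zero keeps the trapping intervals disjoint; the bound 1 serves the
   last zero, which has no successor. *)
have [h h0 hP] : exists2 h, 0 < h & forall j : 'I_n,
    ((0 < p.[r j + h] * D j /\ p.[r j - h] * D j < 0)
     /\ h < if (j.+1 < n)%N then (r j.+1 - r j) / 2 else 1).
  apply: small_ex; apply: small_forall => j; apply: small_and.
    exact: simple_root_sign (p_root j (ltn_ord j)) (DD j).
  apply: small_lt; case: ifP => // /rS; lra.
have near_a : small (fun e => e < a - a0 /\ forall j : 'I_n,
    [/\ (0 < F.[(a + e)%:P].[r j + h] * D j /\ 0 < F.[(a - e)%:P].[r j + h] * D j),
        (0 < F.[(a + e)%:P].[r j - h] * - D j /\ 0 < F.[(a - e)%:P].[r j - h] * - D j)
      & (0 < F.[(a + e)%:P].[r j] * D j /\ F.[(a - e)%:P].[r j] * D j < 0)]).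
  apply: small_and; first by apply: small_lt; lra.
  apply: small_forall => j; have [[h1 h2] _] := hP j.
  have h3 : 0 < p.[r j - h] * - D j by lra.
  have pj := p_root j (ltn_ord j).
  (* From here F is read as a polynomial in alpha at a fixed X. *)
  rewrite -!(horner_poly_at F) -/p in h1 h3.
  have h4 : 0 < (poly_at (r j) F)^`().[a] * D j.
    by rewrite deriv_poly_at horner_poly_at Fsgn.
  have h5 : root (poly_at (r j) F) a by rewrite /root horner_poly_at.
  have [d d0 dP] := small_and (horner_sign_near h1)
    (small_and (horner_sign_near h3) (simple_root_sign h5 h4)).
  exists d => // e e0 ed; have [g1 [g2 g3]] := dP e e0 ed.
  by move: g1 g2 g3; rewrite !horner_poly_at.
have gap j : (j.+1 < n)%N -> r j + h + h < r j.+1.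
  move=> ltjn; have [_] := hP (Ordinal (ltnW ltjn)); rewrite /= ltjn; lra.
case: near_a => d d0 dP; exists d => // e e0 ed; have [ea0 {}dP] := dP e e0 ed.
have ivt (f : {poly R}) u v (c : R) : u < v -> 0 < f.[u] * - c -> 0 < f.[v] * c ->
    exists2 z, u < z < v & root f z.
  move=> uv fu fv; have [||z] := @poly_ivtoo _ f u v; [exact: ltW | | by exists z].
  have c0 : c != 0 by apply: contraTneq fv => ->; rewrite mulr0 ltxx.
  have c2 : 0 < c ^+ 2 by rewrite exprn_even_gt0.
  have E : f.[u] * f.[v] * c ^+ 2 = - ((f.[u] * - c) * (f.[v] * c)) by ring.
  by rewrite -(pmulr_llt0 _ c2) E oppr_lt0 mulr_gt0.
have ae : a0 < a + e by lra.
have ae' : a0 < a - e by lra.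
split.
  have loc := @rootsR_localized _ _ n (fun j => r j - h) r (F0 _ ae) (Fsz _ ae).
  suff /andP[] : r i - h < (rootsR F.[(a + e)%:P])`_i < r i by [].
  apply: loc lt_in => [j ltjn|j /gap]; last lra.
  have [_ [h1 _] [h2 _]] := dP (Ordinal ltjn).
  by apply: ivt h1 h2; rewrite /=; lra.
have loc := @rootsR_localized _ _ n r (fun j => r j + h) (F0 _ ae') (Fsz _ ae').
suff /andP[] : r i < (rootsR F.[(a - e)%:P])`_i < r i + h by [].
apply: loc lt_in => [j ltjn|j /gap]; last lra.
have [[_ h1] _ [_ h2]] := dP (Ordinal ltjn).
by apply: (ivt _ _ _ (D j)) => //=; [lra | rewrite mulrN oppr_gt0].
Qed.

(** * The quantum q-Krawtchouk weight *)

Lemma rootsRZ (R : rcfType) (c : R) (p : {poly R}) :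
  c != 0 -> rootsR (c *: p) = rootsR p.
Proof.
move=> c0; have [->|p0] := eqVneq p 0; first by rewrite scaler0.
apply: lt_sorted_eq; try exact: sorted_roots.
by move=> z; rewrite !mem_rootsR ?rootZ // scaler_eq0 negb_or c0.
Qed.

(** Logarithmic differentiation: the factor 1 - alpha q^(j+1) contributes q^(j+1) / (alpha q^(j+1) -
    1). *)
Lemma deriv_qpoch_horner (R : fieldType) (q a : R) k :
  (forall j, (j < k)%N -> a * q ^+ j.+1 - 1 != 0) ->
  (qpoch (q *: 'X) q%:P k)^`().[a]
  = qpoch (q * a) q k * \sum_(j < k) q ^+ j.+1 / (a * q ^+ j.+1 - 1).
Proof.
elim: k => [|k IHk] nz.
  by rewrite /qpoch !big_ord0 derivC horner0 mulr0.
rewrite qpochS derivM hornerD !hornerM IHk; last by move=> j /ltnW; exact: nz.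
rewrite big_ord_recr /= qpochS horner_qpoch -polyC_exp derivB derivC derivM derivC.
rewrite derivZ derivX !hornerE /= [q * a * _]mulrAC [q * q ^+ k]mulrC -exprSr.
rewrite [q ^+ k.+1 * a]mulrC.
have := nz k (ltnSn k); move: (a * q ^+ k.+1) (\sum_(i < k) _) (qpoch _ _ _).
by move=> b S P h; field.
Qed.

Section Weights.
Variables (R : realType) (q : R) (M n : nat).
Hypotheses (q_gt0 : 0 < q) (q_lt1 : q < 1) (le_nM : (n <= M)%N).
Variable a : R.
Hypothesis a_gt : q ^- M < a.

Let q_neq0 : q != 0. Proof. by rewrite gt_eqF. Qed.

Lemma qexpn_lt1 k : 0 < 1 - q ^+ k.+1.
Proof. by rewrite subr_gt0 exprn_ilt1 // ltW. Qed.

Let q_nonroot k : 1 - q ^+ k.+1 != 0. Proof. by rewrite gt_eqF // qexpn_lt1. Qed.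

Lemma alpha_gt0 : 0 < a.
Proof. by apply: lt_trans a_gt; rewrite invr_gt0 exprn_gt0. Qed.

(** The bound on alpha enters here: alpha q^(j+1) > q^(j+1-M) >= 1. *)
Lemma weight_factor_gt0 j : (j < M)%N -> 0 < a * q ^+ j.+1 - 1.
Proof.
move=> lt_jM; rewrite subr_gt0; apply: (@le_lt_trans _ _ (q ^- M * q ^+ j.+1)).
  rewrite -(subnK lt_jM) exprD invfM mulrC mulrCA mulfV ?mulr1 ?expf_neq0 //.
  by rewrite invf_ge1 ?exprn_gt0 // exprn_ile1 // ltW.
by rewrite ltr_pM2r // exprn_gt0.
Qed.

(** The M - s factors 1 - alpha q^(j+1) are all negative, and (-1)^(M+s) compensates their signs. *)
Lemma qtm_weight_gt0 (s : 'I_M.+1) : 0 < (qtm_weight q M s).[a].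
Proof.
have le_sM := ltnSE (ltn_ord s).
have qq k : 0 < qpoch q q k.
  by apply: prodr_gt0 => j _; rewrite -exprS qexpn_lt1.
rewrite hornerZ horner_qpoch hornerZ hornerX.
have -> : qpoch (q * a) q (M - s)
    = (-1) ^+ (M - s) * \prod_(j < M - s) (a * q ^+ j.+1 - 1).
  rewrite -[X in (-1) ^+ X]card_ord -prodr_const -big_split /=.
  by apply: eq_bigr => j _; rewrite exprS; ring.
have -> : (-1) ^+ (M + s) = (-1) ^+ (M - s) :> R.
  by rewrite -signr_odd oddD -oddB // signr_odd.
have sg : (-1) ^+ (M - s) * (-1) ^+ (M - s) = 1 :> R.
  by rewrite -exprD addnn -mul2n exprM sqrrN !expr1n.
set P := \prod_(j < _) _; set e := (-1) ^+ (M - s) in sg *.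
set c := (qpoch _ _ _ * _)^-1.
have -> : e * q ^+ 'C(s, 2) * c * (e * P) = (e * e) * (q ^+ 'C(s, 2) * c * P) by ring.
rewrite sg mul1r !mulr_gt0 ?exprn_gt0 ?invr_gt0 ?mulr_gt0 //.
apply: prodr_gt0 => j _; apply: weight_factor_gt0.
exact: leq_trans (ltn_ord j) (leq_subr _ _).
Qed.

Let l (s : 'I_M.+1) := \sum_(j < M - s) q ^+ j.+1 / (a * q ^+ j.+1 - 1).

Lemma qtm_weight_deriv (s : 'I_M.+1) :
  (qtm_weight q M s)^`().[a] = (qtm_weight q M s).[a] * l s.
Proof.
rewrite derivZ !hornerZ deriv_qpoch_horner ?horner_qpoch ?hornerZ ?hornerX ?mulrA //.
move=> j lt_j; rewrite gt_eqF // weight_factor_gt0 //.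
exact: leq_trans lt_j (leq_subr _ _).
Qed.

Lemma qtm_node_lt (i j : 'I_M.+1) : (q ^- i < q ^- j) = (i < j)%N.
Proof. by rewrite ltf_pV2 ?posrE ?exprn_gt0 // ltr_iXn2l. Qed.

Lemma qtm_node_inj : injective (fun s : 'I_M.+1 => q ^- s).
Proof.
move=> i j /= E; apply/val_inj/eqP; rewrite eqn_leq.
by rewrite leqNgt -qtm_node_lt E ltxx leqNgt -qtm_node_lt E ltxx.
Qed.

(** The sum [l s] has M - s terms, all positive, so passing to a larger node only drops terms. *)
Lemma qtm_logderiv_decr (i j : 'I_M.+1) : q ^- i < q ^- j -> l j < l i.
Proof.
rewrite qtm_node_lt => lt_ij; rewrite /l.
have pos k : (k < M)%N -> 0 < q ^+ k.+1 / (a * q ^+ k.+1 - 1).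
  by move=> lt_k; rewrite divr_gt0 ?exprn_gt0 // weight_factor_gt0.
have lt_ji : (M - j < M - i)%N by have := ltn_ord j; lia.
rewrite -!(big_mkord xpredT (fun k => q ^+ k.+1 / (a * q ^+ k.+1 - 1))).
rewrite (big_cat_nat _ (ltnW lt_ji)) //= ltrDl big_ltn // ltr_pwDl ?pos //; first lia.
rewrite big_nat; apply: sumr_ge0 => k /andP[_ lt_k]; apply/ltW/pos; lia.
Qed.

Lemma qtm_bipoly_size_rootsR : size (rootsR (qtm_bipoly q M n).[a%:P]) = n.
Proof.
have a0 : a != 0 by rewrite gt_eqF // alpha_gt0.
apply: (orthogonal_size_rootsR qtm_node_inj qtm_weight_gt0).
- by rewrite card_ord ltnS.
- exact: size_qtm_bipoly.
- by move=> h; exact: qtm_orthogonal.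
Qed.

Lemma qtm_bipoly_sign z : root (qtm_bipoly q M n).[a%:P] z ->
  0 < (qtm_bipoly q M n)^`().[a%:P].[z] * (qtm_bipoly q M n).[a%:P]^`().[z].
Proof.
have a0 : a != 0 by rewrite gt_eqF // alpha_gt0.
apply: (markov_sign (n := n) qtm_node_inj qtm_weight_gt0 _ _ _ qtm_logderiv_decr).
- by rewrite card_ord ltnS.
- exact: size_qtm_bipoly.
- by move=> h; exact: qtm_orthogonal.
- exact: size_deriv_qtm_bipoly.
- move=> h hn; rewrite -[RHS](qtm_orthogonal_deriv q_neq0 q_nonroot le_nM a hn).
  by apply: eq_bigr => s _; rewrite qtm_weight_deriv.
Qed.
End Weights.

Theorem proposition3p12 (R : realType) (q : R) (N n : nat)
    (hq0 : 0 < q) (hq1 : q < 1) (hn0 : (0 < n)%N) (hnN : (n < N)%N) :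
  (forall alpha : R, q ^ (1 - N%:Z) < alpha ->
     size (qtm_qKrawtchouk_zeros q N n alpha) = n) /\
  (forall i : nat, (i < n)%N ->
     forall alpha beta : R, q ^ (1 - N%:Z) < alpha -> alpha < beta ->
       qtm_qKrawtchouk_zero q N n i beta < qtm_qKrawtchouk_zero q N n i alpha).
Proof.
case: N hnN => // M; rewrite ltnS => le_nM.
have q0 : q != 0 by rewrite gt_eqF.
have q1 k : 1 - q ^+ k.+1 != 0 by rewrite gt_eqF // qexpn_lt1.
have eM : q ^ (1 - M.+1%:Z) = q ^- M.
  by rewrite intS opprD addNKr exprnN.
(* The prefactor (q^(-N); q)_n / (alpha^n q^(n^2)) is nonzero, as n <= N and alpha > 0, so dropping
   it preserves the zeros. *)
have rootsE a : q ^- M < a ->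
    qtm_qKrawtchouk_zeros q M.+1 n a = rootsR (qtm_bipoly q M n).[a%:P].
  move=> /(alpha_gt0 hq0) a0; rewrite /qtm_qKrawtchouk_zeros /qtm_qKrawtchouk.
  rewrite eM -!exprnN -qtm_bipolyE rootsRZ // mulf_neq0 ?invr_neq0 //.
    by rewrite qpochV_neq0 // leqW.
  by rewrite mulf_neq0 ?expf_neq0 // gt_eqF.
rewrite eM; split=> [a a_gt|i lt_in a b a_gt ab].
  by rewrite rootsE // qtm_bipoly_size_rootsR.
rewrite /qtm_qKrawtchouk_zero !rootsE ?(lt_trans a_gt ab) //.
apply: (@rootsR_decreasing _ _ (q ^- M) n) => // c.
- move=> c_gt; rewrite -size_poly_gt0 size_qtm_bipoly //.
  by rewrite gt_eqF // (alpha_gt0 hq0 c_gt).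
- exact: qtm_bipoly_size_rootsR.
- by move=> z c_gt; exact: qtm_bipoly_sign.
Qed.
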